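(* Let $n \geq 2$ and let $\mathcal{TD}_n \subseteq \mathbb{C}^{n\times n}$ be the affine variety of $n \times n$ tridiagonal matrices. For every integer $r$ with $1 \leq r \leq n-1$, $\mu_r(\mathcal{TD}_n)$ is the variety of all $n\times n$ $(2r+1)$-diagonal matrices. In particular, $$\dim \mu_r(\mathcal{TD}_n) = n + 2\sum_{l=1}^{r}(n-l),$$ and hence $\mathbf{FL}_{\mathrm{gen}}(\mathcal{TD}_n) = n-1$ and $\mathbf{FL}_{\mathrm{max}}(\mathcal{TD}_n) \leq 4(n-1)$.
   Context: For an affine variety $X \subseteq \mathbb{C}^{n\times n}$ and an integer $r \geq 1$, let $\mu_r^0(X) = \{M_1\cdots M_r : M_1,\dots,M_r \in X\}$ and let $\mu_r(X)$ be the Zariski closure of $\mu_r^0(X)$ in $\mathbb{C}^{n\times n}$. Define $\mathbf{FL}_{\mathrm{max}}(X) = \min\{r \geq 1 : \mu_r^0(X) = \mathbb{C}^{n\times n}\}$ and $\mathbf{FL}_{\mathrm{gen}}(X) = \min\{r \geq 1 : \mu_r(X) = \mathbb{C}^{n\times n}\}$. A matrix $A=[a_{ij}] \in \mathbb{C}^{n \times n}$ is called $(2k+1)$-diagonal if $a_{ij}=0$ whenever $|i-j| \geq k+1$; tridiagonal means $3$-diagonal, i.e. $a_{ij}=0$ whenever $|i-j|\ge 2$. *)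

(* Defs.v *)
From HB Require Import structures.
From mathcomp Require Import all_boot all_order all_algebra.
From mathcomp Require Import classical_sets reals.
From mathcomp Require Import complex.
From mathcomp Require mpoly.

Set Implicit Arguments.
Unset Strict Implicit.
Unset Printing Implicit Defensive.

Import GRing.Theory.
Local Open Scope classical_set_scope.
Local Open Scope ring_scope.

Section Defs.
Variables (R : realType) (n : nat).

(* The field of complex numbers is R[i], for R a model of the reals. *)
Local Notation C := R[i].

(* A polynomial function on n x n matrices is a polynomial in the n * n
   entries, which [mxvec] lists in row-major order. *)
Definition mx_eval (p : mpoly.mpoly (n * n) C) (A : 'M[C]_n) : C :=
  mpoly.meval (fun k => mxvec A 0 k) p.

Definition zero_locus (P : set (mpoly.mpoly (n * n) C)) : set 'M[C]_n :=
  [set A | forall p, P p -> mx_eval p A = 0].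

Definition zariski_closed (Z : set 'M[C]_n) : Prop :=
  exists P, Z = zero_locus P.

Definition zariski_closure (S : set 'M[C]_n) : set 'M[C]_n :=
  \bigcap_(Z in [set Z | zariski_closed Z /\ S `<=` Z]) Z.

Definition mu0 (r : nat) (X : set 'M[C]_n) : set 'M[C]_n :=
  [set A | exists M : 'I_r -> 'M[C]_n,
    (forall i, X (M i)) /\ A = \prod_(i < r) M i].

Definition mu (r : nat) (X : set 'M[C]_n) : set 'M[C]_n :=
  zariski_closure (mu0 r X).

Definition is_min (S : set nat) (m : nat) : Prop :=
  S m /\ forall k, S k -> (m <= k)%N.

(* The factorization lengths are relations "the minimum exists and equals r",
   so that no value is assigned when the set of admissible lengths is empty. *)
Definition is_FL_max (X : set 'M[C]_n) (r : nat) : Prop :=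
  is_min [set s | (1 <= s)%N /\ mu0 s X = [set: 'M[C]_n]] r.

Definition is_FL_gen (X : set 'M[C]_n) (r : nat) : Prop :=
  is_min [set s | (1 <= s)%N /\ mu s X = [set: 'M[C]_n]] r.

(* The (2k+1)-diagonal matrices. The difference is taken in int. *)
Definition banded (k : nat) : set 'M[C]_n :=
  [set A : 'M[C]_n | forall i j : 'I_n,
    (k.+1 <= `|(i : nat) - (j : nat)|)%N -> A i j = 0].

Definition tridiagonal : set 'M[C]_n := banded 1.

Definition zariski_irreducible (Z : set 'M[C]_n) : Prop :=
  [/\ zariski_closed Z, Z !=set0 &
    forall F G, zariski_closed F -> zariski_closed G ->
      Z = F `|` G -> Z = F \/ Z = G].

Definition irreducible_chain (X : set 'M[C]_n) (d : nat) : Prop :=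
  exists Z : nat -> set 'M[C]_n,
    (forall i, (i <= d)%N -> zariski_irreducible (Z i) /\ Z i `<=` X) /\
    (forall i, (i < d)%N -> Z i `<` Z i.+1).

(* The Krull dimension of a Zariski closed set X. Since X is closed, its closed
   subsets for the induced topology are the closed sets contained in X. *)
Definition has_dim (X : set 'M[C]_n) (d : nat) : Prop :=
  irreducible_chain X d /\ forall e, irreducible_chain X e -> (e <= d)%N.

End Defs.

Arguments banded : clear implicits.
Arguments tridiagonal : clear implicits.

(* Main.v *)
Require Import Defs.
From mathcomp Require Import all_boot all_order all_algebra.
From mathcomp Require Import classical_sets reals.
From mathcomp Require Import complex.
From mathcomp Require Import boolp.
From mathcomp Require Import mpoly.
From mathcomp Require Import zify ring.

Set Implicit Arguments.
Unset Strict Implicit.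
Unset Printing Implicit Defensive.

Import GRing.Theory.
Local Open Scope classical_set_scope.
Local Open Scope ring_scope.

(** Why the theorem holds.

    A product of [r] tridiagonal matrices is (2r+1)-diagonal, and the
    (2r+1)-diagonal matrices form a linear, hence closed and irreducible,
    subspace. So mu_r equals that subspace as soon as the products contain a
    nonempty relatively open part of it.

    That part comes from Gaussian elimination adapted to bands. Generically, a
    matrix [x] with lower bandwidth [p + 1] and upper bandwidth [q] factors as
    [x = L *m A], with [L] unit lower bidiagonal and [A] of lower bandwidth [p]:
    run down the rows, and from each row subtract the multiple of the row just
    produced above it that clears the outermost entry ([elim], [elim_factor],
    [elim_band]). Reversing the order of rows and columns gives the same for an
    upper bidiagonal factor. One step of each kind yields [x = (L *m U) *m A]
    with [L *m U] tridiagonal and both bandwidths of [A] one smaller; induction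
    on [r] concludes. What has to be controlled is that the pivots do not vanish
    generically. For this a base point [x0] is carried along the induction: the
    entries of [elim x] are rational functions of [x] that are regular at [x0],
    and [elim x0] is the base point of the previous step, so that a Zariski
    neighbourhood of the latter pulls back to a neighbourhood of [x0]
    ([lower_factor_near], [generic_tridiagonal_product]).

    The dimension is that of a coordinate subspace of the space of matrices. A
    flag of coordinate subspaces gives a chain of the right length. For the upper
    bound, a longer chain inside the subspace could be continued by the flag to a
    chain of length [e > n * n] in the whole space. Choose polynomials [f_i]
    that vanish on the [i]-th member of that chain but not on the next. Dividing
    a relation by the lowest power of the last [f_i] and restricting to the
    previous member shows that the [f_i] are algebraically independent
    ([chain_monomials_free]), whereas counting monomials shows that more than
    [n * n] polynomials in [n * n] variables are dependent
    ([digit_monomials_dependent]).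

    For the generic length, (2r+1)-diagonal matrices fill the whole space exactly
    from [r = n - 1] on. For the maximal length, the products of [n - 1]
    tridiagonal matrices contain a nonempty open set, so every invertible matrix
    is a product of two elements of it ([unitmx_mul_generic]), that is, of
    [2 (n - 1)] tridiagonal matrices. An arbitrary matrix is an invertible one,
    times a diagonal idempotent, times an invertible one, and the idempotent is
    absorbed by a neighbouring tridiagonal factor ([mu0_full]). *)

(** * Zariski neighbourhoods, rational functions and irreducibility *)

Section Zariski.
Variables (R : realType) (n : nat).
Local Notation C := R[i].
Local Notation M := 'M[C]_n.
Implicit Types (f g : M -> C) (x y : M) (P Q : M -> Prop) (Z W : set M).

Definition polyfun f := exists p, forall x, f x = mx_eval p x.

Lemma polyfun_mx_eval p : polyfun (@mx_eval R n p).
Proof. by exists p. Qed.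

Lemma polyfun_cst c : polyfun (fun=> c).
Proof. by exists c%:MP => x; rewrite /mx_eval mevalC. Qed.

Lemma polyfun_entry i j : polyfun (fun x => x i j).
Proof. by exists 'X_(mxvec_index i j) => x; rewrite /mx_eval mevalXU mxvecE. Qed.

Lemma polyfunD f g : polyfun f -> polyfun g -> polyfun (fun x => f x + g x).
Proof.
by move=> [p pE] [q qE]; exists (p + q) => x; rewrite pE qE /mx_eval mevalD.
Qed.

Lemma polyfunM f g : polyfun f -> polyfun g -> polyfun (fun x => f x * g x).
Proof.
by move=> [p pE] [q qE]; exists (p * q) => x; rewrite pE qE /mx_eval mevalM.
Qed.

Lemma polyfun_sum (I : Type) (s : seq I) (F : I -> M -> C) :
  (forall i, polyfun (F i)) -> polyfun (fun x => \sum_(i <- s) F i x).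
Proof.
move=> FP; elim: s => [|i s IH].
  under eq_fun do rewrite big_nil; exact: polyfun_cst.
by under eq_fun do rewrite big_cons; apply: polyfunD.
Qed.

Lemma polyfunX f j : polyfun f -> polyfun (fun x => f x ^+ j).
Proof.
move=> fP; elim: j => [|j IH].
  under eq_fun do rewrite expr0; exact: polyfun_cst.
by under eq_fun do rewrite exprS; apply: polyfunM.
Qed.

(** [g] is a total function, with the division of the field sending [0] to [0];
    asking for one fraction valid wherever its denominator is nonzero makes
    these functions stable under the field operations, inverses being taken of
    functions that are nonzero at [x0]. *)
Definition regular_at x0 g := exists a b,
  [/\ polyfun a, polyfun b, b x0 != 0 & forall x, b x != 0 -> g x = a x / b x].

(** Principal open sets form a base of the Zariski topology, so this is the
    filter of Zariski neighbourhoods of [x0]. *)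
Definition znear x0 P := exists f,
  [/\ polyfun f, f x0 != 0 & forall x, f x != 0 -> P x].

Lemma regular_polyfun x0 f : polyfun f -> regular_at x0 f.
Proof.
move=> fP; exists f, (fun=> 1); split=> //; first exact: polyfun_cst.
  exact: oner_neq0.
by move=> x _; rewrite divr1.
Qed.

Lemma regular_cst x0 c : regular_at x0 (fun=> c).
Proof. exact/regular_polyfun/polyfun_cst. Qed.

Lemma regular_entry x0 i j : regular_at x0 (fun x => x i j).
Proof. exact/regular_polyfun/polyfun_entry. Qed.

Lemma regularD x0 f g : regular_at x0 f -> regular_at x0 g ->
  regular_at x0 (fun x => f x + g x).
Proof.
move=> [a [b [aP bP b0 fE]]] [c [d [cP dP d0 gE]]].
exists (fun x => a x * d x + c x * b x), (fun x => b x * d x); split.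
- by apply: polyfunD; apply: polyfunM.
- exact: polyfunM.
- by rewrite mulf_neq0.
- move=> x; rewrite mulf_eq0 negb_or => /andP[bx dx].
  by rewrite fE // gE // addf_div.
Qed.

Lemma regularM x0 f g : regular_at x0 f -> regular_at x0 g ->
  regular_at x0 (fun x => f x * g x).
Proof.
move=> [a [b [aP bP b0 fE]]] [c [d [cP dP d0 gE]]].
exists (fun x => a x * c x), (fun x => b x * d x); split.
- exact: polyfunM.
- exact: polyfunM.
- by rewrite mulf_neq0.
- move=> x; rewrite mulf_eq0 negb_or => /andP[bx dx].
  by rewrite fE // gE // mulf_div.
Qed.

Lemma regularN x0 f : regular_at x0 f -> regular_at x0 (fun x => - f x).
Proof.
move=> fP; have := regularM (regular_cst x0 (-1)) fP.
by under eq_fun do rewrite mulN1r.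
Qed.

Lemma regularV x0 f : regular_at x0 f -> f x0 != 0 ->
  regular_at x0 (fun x => (f x)^-1).
Proof.
move=> [a [b [aP bP b0 fE]]] f0.
have a0 : a x0 != 0 by apply: contraNneq f0 => a0; rewrite fE // a0 mul0r.
exists (fun x => b x * b x), (fun x => a x * b x); split.
- exact: polyfunM.
- exact: polyfunM.
- by rewrite mulf_neq0.
- move=> x; rewrite mulf_eq0 negb_or => /andP[ax bx].
  by rewrite fE // invf_div -mulf_div divff // mulr1.
Qed.

Lemma regular_sum x0 (I : Type) (s : seq I) (F : I -> M -> C) :
  (forall i, regular_at x0 (F i)) ->
  regular_at x0 (fun x => \sum_(i <- s) F i x).
Proof.
move=> FP; elim: s => [|i s IH].
  under eq_fun do rewrite big_nil; exact: regular_cst.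
by under eq_fun do rewrite big_cons; apply: regularD.
Qed.

Lemma regular_prod x0 (I : Type) (s : seq I) (F : I -> M -> C) :
  (forall i, regular_at x0 (F i)) ->
  regular_at x0 (fun x => \prod_(i <- s) F i x).
Proof.
move=> FP; elim: s => [|i s IH].
  under eq_fun do rewrite big_nil; exact: regular_cst.
by under eq_fun do rewrite big_cons; apply: regularM.
Qed.

(** A polynomial in rational functions regular at [x0] is again one, because
    evaluation only uses sums and products. *)
Lemma regular_comp x0 f (G : M -> M) :
  (forall i j, regular_at x0 (fun x => G x i j)) -> polyfun f ->
  regular_at x0 (fun x => f (G x)).
Proof.
move=> GP [p pE]; under eq_fun do rewrite pE /mx_eval mevalE.
apply: regular_sum => m; apply: regularM; first exact: regular_cst.
apply: regular_prod => k; case/mxvec_indexP: k => i j; elim: (m _) => [|d IH].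
  under eq_fun do rewrite expr0; exact: regular_cst.
under eq_fun do rewrite exprS mxvecE.
apply: regularM; first exact: GP.
by move: IH; under eq_fun do rewrite mxvecE.
Qed.

Lemma znear_sub x0 P Q : (forall x, P x -> Q x) -> znear x0 P -> znear x0 Q.
Proof. by move=> PQ [f [fP f0 fE]]; exists f; split=> // x /fE/PQ. Qed.

Lemma znearI x0 P Q : znear x0 P -> znear x0 Q -> znear x0 (fun x => P x /\ Q x).
Proof.
move=> [f [fP f0 fE]] [g [gP g0 gE]]; exists (fun x => f x * g x); split.
- exact: polyfunM.
- by rewrite mulf_neq0.
- by move=> x; rewrite mulf_eq0 negb_or => /andP[/fE ? /gE].
Qed.

Lemma znear_always x0 P : (forall x, P x) -> znear x0 P.
Proof.
move=> PP; exists (fun=> 1); split=> //; [exact: polyfun_cst|exact: oner_neq0].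
Qed.

Lemma znear_forall_lt x0 N (P : nat -> M -> Prop) :
  (forall k, (k < N)%N -> znear x0 (P k)) ->
  znear x0 (fun x => forall k, (k < N)%N -> P k x).
Proof.
elim: N => [|N IH] PP; first exact: znear_always.
have := znearI (PP N (leqnn _)) (IH (fun k kN => PP k (ltnW kN))).
apply: znear_sub => x [PN Pk] k; rewrite ltnS leq_eqVlt.
by case/orP => [/eqP->|/Pk].
Qed.

Lemma znear_neq0 x0 f : regular_at x0 f -> f x0 != 0 ->
  znear x0 (fun x => f x != 0).
Proof.
move=> [a [b [aP bP b0 fE]]] f0; exists (fun x => a x * b x); split.
- exact: polyfunM.
- rewrite mulf_neq0 //; apply: contraNneq f0 => a0.
  by rewrite fE // a0 mul0r.
- move=> x; rewrite mulf_eq0 negb_or => /andP[ax bx].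
  by rewrite fE // mulf_neq0 ?invr_eq0.
Qed.

(** Continuity of rational maps where they are regular. *)
Lemma znear_comp x0 (G : M -> M) P :
  (forall i j, regular_at x0 (fun x => G x i j)) ->
  znear (G x0) P -> znear x0 (fun x => P (G x)).
Proof.
move=> GP [f [fP f0 fE]].
by apply: znear_sub (znear_neq0 (regular_comp GP fP) f0) => x /fE.
Qed.

Lemma polyfun_line f x y : polyfun f ->
  exists q : {poly C}, forall s, f (x + s *: (y - x)) = q.[s].
Proof.
move=> [p pE]; exists (\sum_(m <- msupp p) p@_m *:
  \prod_i ((mxvec x 0 i)%:P + (mxvec (y - x) 0 i) *: 'X) ^+ m i) => s.
rewrite pE /mx_eval mevalE horner_sum; apply: eq_bigr => m _.
rewrite hornerZ horner_prod; congr (_ * _); apply: eq_bigr => i _.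
by rewrite horner_exp !hornerE linearD linearZ /= !mxE [s * _]mulrC.
Qed.

(** On the line joining [x] and [y], [f] and [g] are nonzero polynomials in one
    variable, and an infinite field contains a common non-root. *)
Lemma line_avoids f g x y : polyfun f -> polyfun g -> f x != 0 -> g y != 0 ->
  exists s, let z := x + s *: (y - x) in f z != 0 /\ g z != 0.
Proof.
move=> fP gP fx gy.
have [q qE] := polyfun_line x y fP; have [r rE] := polyfun_line x y gP.
have q0 : q != 0.
  by apply: contraNneq fx => q0; rewrite -[x]addr0 -(scale0r (y - x)) qE q0 horner0.
have r0 : r != 0.
  apply: contraNneq gy => r0.
  by rewrite -[y](subrKC x) -[y - x](scale1r) rE r0 horner0.
have [s] := closed_nonrootP _ (mulf_neq0 q0 r0).
rewrite rootM negb_or => /andP[qs rs]; exists s => /=.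
by rewrite qE rE.
Qed.

(** Nonempty open sets meet: the space of matrices is irreducible. *)
Lemma znear_meet x y P Q : znear x P -> znear y Q -> exists z, P z /\ Q z.
Proof.
move=> [f [fP fx fE]] [g [gP gy gE]].
have [s /= [fz gz]] := line_avoids fP gP fx gy.
by exists (x + s *: (y - x)); split; [exact: fE|exact: gE].
Qed.

Lemma closed_separated Z x : zariski_closed Z -> ~ Z x ->
  exists f, [/\ polyfun f, forall y, Z y -> f y = 0 & f x != 0].
Proof.
move=> [E ->] /existsNP[p /not_implyP[Ep /eqP px]].
exists (mx_eval p); split=> //; first exact: polyfun_mx_eval.
by move=> y; apply.
Qed.

Lemma closed_setI_zero Z f : zariski_closed Z -> polyfun f ->
  zariski_closed (Z `&` [set x | f x = 0]).
Proof.
move=> [E ->] [p pE]; exists (E `|` [set p]); apply/seteqP; split=> x /=.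
  by move=> [Ex fx] q [/Ex//|->]; rewrite -pE.
move=> Ex; split; first by move=> q Eq; apply: Ex; left.
by rewrite pE; apply: Ex; right.
Qed.

(** If [W] were a union of two smaller closed sets, some polynomials [f] and [g]
    would vanish on one of them each and be nonzero at some point of [W]; the
    line joining the two points then leaves both sets while staying in [W]. *)
Lemma affine_irreducible W : zariski_closed W -> W !=set0 ->
  (forall x y s, W x -> W y -> W (x + s *: (y - x))) -> zariski_irreducible W.
Proof.
move=> Wc W0 Wline; split=> // F G Fc Gc WE.
apply/or_asboolP; apply: contraT; rewrite negb_or => /andP[/asboolPn WF /asboolPn WG].
have out (H : set M) : H `<=` W -> W <> H -> exists2 x, W x & ~ H x.
  move=> HW WH; apply: contrapT => /forall2NP no; apply: WH; apply/seteqP.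
  by split=> // x Wx; have [//|/contrapT] := no x.
have [|x Wx Fx] := out F _ WF; first by rewrite WE; exact: subsetUl.
have [|y Wy Gy] := out G _ WG; first by rewrite WE; exact: subsetUr.
have [f [fP fF fx]] := closed_separated Fc Fx.
have [g [gP gG gy]] := closed_separated Gc Gy.
have [s /= [fz gz]] := line_avoids fP gP fx gy.
have : W (x + s *: (y - x)) by exact: Wline.
rewrite {1}WE => -[/fF fz0|/gG gz0].
- by move: fz; rewrite fz0 eqxx.
- by move: gz; rewrite gz0 eqxx.
Qed.

(** The coordinate ring of an irreducible set is an integral domain: [Z] is
    covered by the zeros of [f] and those of [g]. *)
Lemma irreducible_domain Z f g : zariski_irreducible Z ->
  polyfun f -> polyfun g -> (forall x, Z x -> f x * g x = 0) ->
  (exists2 x, Z x & f x != 0) -> forall x, Z x -> g x = 0.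
Proof.
move=> [Zc _ Zirr] fP gP fg [x0 Zx0 fx0].
have ZE : Z = (Z `&` [set x | f x = 0]) `|` (Z `&` [set x | g x = 0]).
  apply/seteqP; split=> [x Zx|x [[]//|[]//]].
  by have /eqP := fg x Zx; rewrite mulf_eq0 => /orP[]/eqP; [left|right].
have [ZF|ZG] := Zirr _ _ (closed_setI_zero Zc fP) (closed_setI_zero Zc gP) ZE.
  by move: Zx0; rewrite ZF => -[_ /= f0]; rewrite f0 eqxx in fx0.
by move=> x; rewrite {1}ZG => -[].
Qed.

End Zariski.

(** * Dimension of the space of matrices *)

Section DigitMonomials.
Variables (F : fieldType) (N : nat).
Implicit Types p : nat -> {mpoly F[N]}.

(** The product of the [p i ^+ d_i], [i < k], for [d_i] the base-[t] digits of
    [a]. As [a] runs below [t ^ k], this lists all monomials with exponents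
    less than [t], and fixing the leading digit cuts the list into blocks. *)
Fixpoint digit_monomial p t k a : {mpoly F[N]} :=
  if k is k'.+1 then
    digit_monomial p t k' (a %% t ^ k')%N * p k' ^+ (a %/ t ^ k')%N
  else 1.

Lemma msizeM_leS (q r : {mpoly F[N]}) d d' :
  (msize q <= d.+1)%N -> (msize r <= d'.+1)%N -> (msize (q * r) <= (d + d').+1)%N.
Proof.
have [->|q0] := eqVneq q 0; first by rewrite mul0r msize0.
have [->|r0] := eqVneq r 0; first by rewrite mulr0 msize0.
rewrite msizeM //; move: (msize q) (msize r) => a b; lia.
Qed.

Lemma msizeX_leS (q : {mpoly F[N]}) d j :
  (msize q <= d.+1)%N -> (msize (q ^+ j) <= (j * d).+1)%N.
Proof.
move=> qd; elim: j => [|j IH]; first by rewrite expr0 msize1.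
by rewrite exprS mulSn; apply: msizeM_leS.
Qed.

Lemma msize_digit_monomial p t k a d : (a < t ^ k)%N ->
  (forall i, (i < k)%N -> (msize (p i) <= d.+1)%N) ->
  (msize (digit_monomial p t k a) <= (k * d * t).+1)%N.
Proof.
elim: k a => [|k IH] a; first by rewrite msize1.
move=> ak pd; have tk0 : (0 < t ^ k)%N by move: ak; rewrite expnS; case: (t ^ k)%N; lia.
have -> : (k.+1 * d * t = k * d * t + t * d)%N by lia.
apply: leq_trans (_ : (k * d * t + (a %/ t ^ k) * d).+1 <= _)%N; last first.
  rewrite ltnS leq_add2l leq_mul2r; apply/orP; right.
  by apply: ltnW; rewrite ltn_divLR // -expnS.
apply: msizeM_leS; last by apply: msizeX_leS; exact: pd.
by apply: IH => [|i ik]; [rewrite ltn_mod|apply: pd; exact: ltnW].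
Qed.

Lemma card_bmultinom b : (#|{: 'X_{1..N < b}}| <= b ^ N)%N.
Proof.
have lt (m : 'X_{1..N < b}) i : ((m : 'X_{1..N}) i < b)%N.
  apply: leq_ltn_trans (bmdeg m); rewrite mdegE (bigD1 i) //=; exact: leq_addr.
rewrite -[b in (_ <= b ^ _)%N]card_ord -[N in (_ <= _ ^ N)%N]card_ord -card_ffun.
apply: (@leq_card _ _ (fun m : 'X_{1..N < b} => [ffun i => Ordinal (lt m i)])).
move=> m m' /ffunP mm'; apply/val_inj/mnmP => i.
by have := congr1 val (mm' i); rewrite !ffunE.
Qed.

(** Polynomials of size at most [b] live in a space of dimension at most
    [b ^ N]. *)
Lemma mpoly_lin_dep m b (q : 'I_m -> {mpoly F[N]}) :
  (forall i, (msize (q i) <= b)%N) -> (b ^ N < m)%N ->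
  exists c : 'I_m -> F, (exists i, c i != 0) /\ \sum_i c i *: q i = 0.
Proof.
move=> qb bm; pose Q := \matrix_(i < m, j < #|{: 'X_{1..N < b}}|) (q i)@_(enum_val j).
have : kermx Q != 0.
  rewrite kermx_eq0 neq_ltn; apply/orP; left; apply: leq_ltn_trans bm.
  exact: leq_trans (rank_leq_col Q) (card_bmultinom b).
move=> /rowV0Pn[v /sub_kermxP vQ] v0; exists (fun i => v 0 i); split.
  have [i vi|v00] := pickP (fun i => v 0 i != 0); first by exists i.
  by case/eqP: v0; apply/rowP => i; have /negbFE/eqP := v00 i; rewrite mxE.
apply/mpolyP => k; rewrite mcoeff0 raddf_sum /=.
have [kb|kb] := ltnP (mdeg k) b; last first.
  apply: big1 => i _; rewrite mcoeffZ (_ : (q i)@_k = 0) ?mulr0 //.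
  by apply: memN_msupp_eq0; apply: msize_mdeg_ge; exact: leq_trans (qb i) kb.
have /rowP/(_ (enum_rank (BMultinom kb))) := vQ; rewrite !mxE => vQk.
rewrite -[RHS]vQk; apply: eq_bigr => i _.
by rewrite mcoeffZ !mxE enum_rankK.
Qed.

(** There are [t ^ e] monomials of degree [O(t)], in a space of dimension
    [O(t ^ N)] with [N < e]: too many for large [t]. *)
Lemma digit_monomials_dependent p e : (N < e)%N ->
  exists t (c : nat -> F), (exists2 a, (a < t ^ e)%N & c a != 0) /\
    \sum_(0 <= a < t ^ e) c a *: digit_monomial p t e a = 0.
Proof.
move=> Ne; pose d := (\max_(i < e) msize (p i))%N; pose K := (e * d).+1.
(* chosen so that (K t)^N = K^N t^N < t^(N+1) *)
pose t := (K ^ N).+1.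
have pd i : (i < e)%N -> (msize (p i) <= d.+1)%N.
  move=> ie; apply: leqW; exact: (leq_bigmax (Ordinal ie)).
have dep : ((K * t) ^ N < t ^ e)%N.
  rewrite expnMn; apply: leq_trans (_ : t ^ N.+1 <= _)%N.
    by rewrite expnS ltn_pmul2r ?expn_gt0.
  by rewrite leq_exp2l //  /t ltnS expn_gt0.
have [|c [[i ci] c0]] := mpoly_lin_dep (q := fun i : 'I_(t ^ e) =>
    digit_monomial p t e i) _ dep.
  move=> i; apply: leq_trans (msize_digit_monomial (ltn_ord i) pd) _.
  by rewrite /K mulSn /t; lia.
exists t, (fun a => oapp c 0 (insub a)); split.
  by exists i => //; rewrite valK.
by rewrite big_mkord -[RHS]c0; apply: eq_bigr => j _; rewrite valK.
Qed.

End DigitMonomials.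

Section Dimension.
Variables (R : realType) (n : nat).
Local Notation C := R[i].
Local Notation M := 'M[C]_n.
Implicit Types (f : M -> C) (x : M) (Z W : set M).

(** In a relation [g 0 + f g 1 + f^2 g 2 + ... = 0] on [Z], restricting to [Z'],
    where [f = 0], kills [g 0]; the rest is divisible by [f], which can be
    cancelled since [Z] is irreducible and [f] does not vanish on it. *)
Lemma power_relation_descends Z Z' f (g : nat -> M -> C) t :
  zariski_irreducible Z -> Z' `<=` Z ->
  polyfun f -> (forall x, Z' x -> f x = 0) -> (exists2 x, Z x & f x != 0) ->
  (forall j, polyfun (g j)) ->
  (forall j, (j < t)%N -> (forall x, Z' x -> g j x = 0) -> forall x, g j x = 0) ->
  (forall x, Z x -> \sum_(0 <= j < t) f x ^+ j * g j x = 0) ->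
  forall j, (j < t)%N -> forall x, g j x = 0.
Proof.
move=> Zirr Z'Z fP f0 fn0; elim: t g => [//|t IH] g gP gind rel.
have relE x : \sum_(0 <= j < t.+1) f x ^+ j * g j x =
    g 0%N x + f x * \sum_(0 <= j < t) f x ^+ j * g j.+1 x.
  rewrite big_nat_recl // expr0 mul1r mulr_sumr; congr (_ + _).
  by apply: eq_bigr => j _; rewrite exprS mulrA.
have g0 : forall x, g 0%N x = 0.
  apply: gind => // x Z'x; have := rel x (Z'Z x Z'x).
  by rewrite relE f0 // mul0r addr0.
have := IH (fun j => g j.+1) (fun j => gP j.+1) (fun j jt => gind j.+1 jt) _.
move=> {}IH [|j] jt; first exact: g0.
apply: IH => //; apply: (irreducible_domain Zirr fP _ _ fn0).
  by apply: polyfun_sum => i; apply: polyfunM => //; exact: polyfunX.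
by move=> x Zx; have := rel x Zx; rewrite relE g0 add0r.
Qed.

(** The polynomials [p i] witnessing the strictness of a chain are algebraically
    independent on its last member. *)
Lemma chain_monomials_free (Z : nat -> set M) (p : nat -> {mpoly C[n * n]}) e :
  (forall i, (i <= e)%N -> zariski_irreducible (Z i)) ->
  (forall i, (i < e)%N -> Z i `<=` Z i.+1) ->
  (forall i, (i < e)%N -> (forall x, Z i x -> mx_eval (p i) x = 0) /\
     exists2 x, Z i.+1 x & mx_eval (p i) x != 0) ->
  forall t k (c : nat -> C), (k <= e)%N ->
  (forall x, Z k x ->
     \sum_(0 <= a < t ^ k) c a * mx_eval (digit_monomial p t k a) x = 0) ->
  forall a, (a < t ^ k)%N -> c a = 0.
Proof.
move=> Zirr Zinc Zp t; elim=> [|k IH] c ke rel a.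
  have [_ [x Zx] _] := Zirr 0%N (leq0n _).
  have := rel x Zx; rewrite expn0 big_nat1 /mx_eval meval1 mulr1 => c0.
  by case: a.
(* [g j] is the coefficient of [p k ^+ j]: the block of leading digit [j] *)
pose g j x := \sum_(0 <= a < t ^ k)
  c (j * t ^ k + a)%N * mx_eval (digit_monomial p t k a) x.
have gP j : polyfun (g j).
  apply: polyfun_sum => i; apply: polyfunM; first exact: polyfun_cst.
  exact: polyfun_mx_eval.
have gc j : (forall x, Z k x -> g j x = 0) ->
    forall b, (b < t ^ k)%N -> c (j * t ^ k + b)%N = 0.
  exact: (IH (fun b => c (j * t ^ k + b)%N)) (ltnW ke).
have shift m j (F : nat -> C) :
    \sum_(j * m <= b < j.+1 * m) F b = \sum_(0 <= b < m) F (b + j * m)%N.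
  by rewrite -{1}[(j * m)%N]add0n big_addn mulSn addnK.
have g0 : forall j, (j < t)%N -> forall x, g j x = 0.
  have [p0 pn0] := Zp k ke.
  apply: (power_relation_descends (Zirr _ ke) (Zinc _ ke) _ p0 pn0 gP).
  - exact: polyfun_mx_eval.
  - move=> j _ /gc cj x; rewrite /g big_nat_cond big1 // => b /andP[/andP[_ bt] _].
    by rewrite cj ?mul0r.
  - move=> x Zx; rewrite -[RHS](rel x Zx) expnS big_nat_mul.
    rewrite [RHS]big_mkord big_mkord; apply: eq_bigr => j _.
    rewrite mulr_sumr shift [LHS]big_nat_cond [RHS]big_nat_cond.
    apply: eq_bigr => b /andP[/andP[_ bt] _].
    have tk0 : (0 < t ^ k)%N by apply: leq_ltn_trans bt.
    rewrite [(b + _)%N]addnC /= divnMDl // modnMDl divn_small // modn_small //.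
    by rewrite addn0 /mx_eval mevalM rmorphXn /=; ring.
have tk0 : (a < t ^ k.+1)%N -> (0 < t ^ k)%N.
  by rewrite expnS; case: (t ^ k)%N; lia.
move=> at1; rewrite (divn_eq a (t ^ k)); apply: gc; last by rewrite ltn_mod tk0.
by move=> x _; apply: g0; rewrite ltn_divLR ?tk0 // -expnS.
Qed.

(** Otherwise the [e] polynomials separating the consecutive members of the chain
    would be algebraically independent, and dependent because [n * n < e]. *)
Theorem irreducible_chain_leq e : irreducible_chain [set: M] e -> (e <= n * n)%N.
Proof.
move=> [Z [Zirr Zlt]]; rewrite leqNgt; apply/negP => ne.
have /choice[p pP] : forall i, exists p : {mpoly C[n * n]}, (i < e)%N ->
    (forall x, Z i x -> mx_eval p x = 0) /\ exists2 x, Z i.+1 x & mx_eval p x != 0.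
  move=> i; have [ie|] := boolP (i < e)%N; last by exists 0.
  have [_ /existsNP[x /not_implyP[Zx nZx]]] := Zlt i ie.
  have [[Zc _ _] _] := Zirr i (ltnW ie).
  have [f [[p pE] f0 fx]] := closed_separated Zc nZx.
  exists p => _; split; first by move=> y Zy; rewrite -pE f0.
  by exists x => //; rewrite -pE.
have [t [c [[a at_ ca] rel]]] := digit_monomials_dependent p ne.
case/eqP: ca; apply: (@chain_monomials_free Z p e _ _ _ t e c) => //.
- by move=> i /Zirr[].
- by move=> i /Zlt[].
- move=> x _; have := congr1 (fun q => mx_eval q x) rel.
  rewrite /mx_eval meval0 raddf_sum /= => rel0; rewrite -[RHS]rel0.
  by apply: eq_bigr => b _; rewrite mevalZ.
Qed.

End Dimension.

(** * Dimension of coordinate subspaces and of spaces of band matrices *)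

Section CoordinateSpaces.
Variables (R : realType) (n : nat).
Local Notation C := R[i].
Local Notation M := 'M[C]_n.
Implicit Types (S T : {set 'I_n * 'I_n}) (s : seq ('I_n * 'I_n)).

Definition coord_space S : set M :=
  [set x | forall i j, (i, j) \notin S -> x i j = 0].

Lemma coord_space_closed S : zariski_closed (coord_space S).
Proof.
exists [set p | exists i j, (i, j) \notin S /\ p = 'X_(mxvec_index i j)].
apply/seteqP; split=> x /=.
  by move=> xS _ [i [j [ijS ->]]]; rewrite /mx_eval mevalXU mxvecE xS.
move=> xS i j ijS; rewrite -mxvecE.
have /xS : exists i' j', (i', j') \notin S /\
    ('X_(mxvec_index i j) : {mpoly C[n * n]}) = 'X_(mxvec_index i' j').
  by exists i, j.
by rewrite /mx_eval mevalXU.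
Qed.

Lemma coord_space_irreducible S : zariski_irreducible (coord_space S).
Proof.
apply: affine_irreducible; first exact: coord_space_closed.
  by exists 0 => i j _; rewrite mxE.
by move=> x y s xS yS i j ijS; rewrite !mxE xS ?yS // subr0 mulr0 addr0.
Qed.

Lemma coord_space_proper S T : S \proper T -> coord_space S `<` coord_space T.
Proof.
move=> /properP[/fintype.subsetP ST [[i j] ijT ijS]]; split.
  by move=> x xS i' j' ijT'; apply: xS; apply: contra ijT'; exact: ST.
move=> /(_ (delta_mx i j)) TS; have xT : coord_space T (delta_mx i j).
  move=> i' j' ijT'; rewrite mxE; case: andP => // -[/eqP ii /eqP jj].
  by rewrite ii jj ijT in ijT'.
by have /eqP := TS xT i j ijS; rewrite mxE !eqxx oner_eq0.
Qed.

Lemma take_proper s k : uniq s -> (k < size s)%N ->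
  [set:: take k s] \proper [set:: take k.+1 s].
Proof.
move=> us; case: s us => [//|p s] us ks.
rewrite (take_nth p) //; apply/properP; split.
  by apply/fintype.subsetP => q; rewrite !inE mem_rcons inE => ->; rewrite orbT.
exists (nth p (p :: s) k); rewrite !inE ?mem_rcons ?mem_head //.
by move: us; rewrite -{1}(cat_take_drop k.+1 (p :: s)) (take_nth p) // cat_uniq
  rcons_uniq => /andP[/andP[]].
Qed.

(** The flag of coordinate subspaces obtained by listing the positions of [S]
    first passes through [coord_space S]. Its beginning is a chain of length
    [#|S|], and its end prolongs any chain in [coord_space S] by
    [n * n - #|S|] steps, which [irreducible_chain_leq] allows only if that
    chain has length at most [#|S|]. *)
Lemma coord_space_dim S : has_dim (coord_space S) #|S|.
Proof.
pose s := enum S ++ enum (~: S).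
have us : uniq s.
  rewrite cat_uniq !enum_uniq andbT /=; apply/hasPn => p.
  by rewrite !mem_enum inE.
have ss : size s = (n * n)%N.
  by rewrite size_cat -!cardE cardsC card_prod card_ord.
have Sn : (#|S| <= n * n)%N by rewrite -ss size_cat -cardE leq_addr.
pose flag k := coord_space [set:: take k s].
have flagP k : (k < n * n)%N -> flag k `<` flag k.+1.
  by move=> kn; apply/coord_space_proper/take_proper => //; rewrite ss.
have flagS : flag #|S| = coord_space S.
  rewrite /flag take_size_cat ?cardE //; congr coord_space.
  by apply/setP => p; rewrite !inE mem_enum.
have flag_mono k : (k <= #|S|)%N -> flag k `<=` coord_space S.
  move=> kS x xk i j ijS; apply: xk; apply: contra ijS.
  by rewrite inE takel_cat -?cardE // => /mem_take; rewrite mem_enum.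
split.
  exists flag; split; last by move=> i iS; apply: flagP; exact: leq_trans iS Sn.
  by move=> i iS; split; [exact: coord_space_irreducible|exact: flag_mono].
move=> e [Z [Zirr Zlt]].
pose Z' i := if (i <= e)%N then Z i else flag (#|S| + (i - e))%N.
have : irreducible_chain [set: M] (e + (n * n - #|S|)).
  exists Z'; split=> i ie.
    split=> //; rewrite /Z'; case: ifP => [/Zirr[]//|_].
    exact: coord_space_irreducible.
  rewrite /Z'; have [ie'|ie'|ie'] := ltngtP i e.
  - exact: Zlt.
  - by rewrite subSn ?(ltnW ie') // addnS; apply: flagP; lia.
  - rewrite ie' subSnn addn1; have /flagP : (#|S| < n * n)%N by lia.
    rewrite flagS => -[SF FS]; have [_ ZS] := Zirr e (leqnn e).
    split; first exact: subset_trans SF.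
    by move=> FZ; apply: FS; exact: subset_trans ZS.
by move/irreducible_chain_leq; lia.
Qed.

Definition band_set r : {set 'I_n * 'I_n} :=
  [set p : 'I_n * 'I_n | (`|(p.1 : nat) - (p.2 : nat)| <= r)%N]%SET.

Lemma bandedE r : banded R n r = coord_space (band_set r).
Proof.
by apply/seteqP; split=> x xP i j; [rewrite inE -ltnNge|]; move=> ij; apply: xP;
  rewrite ?inE -?ltnNge.
Qed.

Lemma card_diagonal l : (l < n)%N ->
  #|[set p : 'I_n * 'I_n | p.2 == (p.1 + l)%N :> nat]%SET| = (n - l)%N.
Proof.
move=> ln; have lt1 (k : 'I_(n - l)) : (k < n)%N by have := ltn_ord k; lia.
have lt2 (k : 'I_(n - l)) : (k + l < n)%N by have := ltn_ord k; lia.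
pose h k := (Ordinal (lt1 k), Ordinal (lt2 k)).
rewrite -[RHS]card_ord -cardsT -(card_imset _ (f := h)); last first.
  by move=> k k' [kk _]; exact: val_inj.
apply: eq_card => -[i j]; rewrite inE /=; apply/eqP/imsetP => [ij|[k _ [-> ->]] //].
have kl : (i < n - l)%N by have := ltn_ord j; lia.
by exists (Ordinal kl) => //; congr pair; exact: val_inj.
Qed.

(** Enlarging the half-bandwidth to [l] adds two diagonals with [n - l]
    positions each. *)
Lemma card_band_set r : (r <= n - 1)%N -> (0 < n)%N ->
  #|band_set r| = (n + 2 * \sum_(1 <= l < r.+1) (n - l))%N.
Proof.
move=> + n0; elim: r => [_|r IH rn].
  rewrite big_geq // muln0 addn0 -[RHS]subn0 -(card_diagonal n0).
  by apply: eq_card => -[i j]; rewrite !inE /=; lia.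
rewrite big_nat_recr //= mulnDr addnA -IH; last exact: ltnW.
have rn' : (r.+1 < n)%N by lia.
pose U := [set p : 'I_n * 'I_n | p.2 == (p.1 + r.+1)%N :> nat]%SET.
pose L := [set p : 'I_n * 'I_n | p.1 == (p.2 + r.+1)%N :> nat]%SET.
have cU : #|U| = (n - r.+1)%N by exact: card_diagonal.
have cL : #|L| = (n - r.+1)%N.
  rewrite -cU -(card_imset (mem U) (f := fun p => (p.2, p.1))).
    apply: eq_card => -[i j]; rewrite inE /=; apply/eqP/imsetP => [ij|].
      by exists (j, i); rewrite // inE /=; apply/eqP.
    by move=> [[i' j'] + [-> ->]]; rewrite inE /= => /eqP.
  by move=> [i j] [i' j'] /= [-> ->].
have -> : band_set r.+1 = band_set r :|: (U :|: L).
  by apply/setP => -[i j]; rewrite !inE /=; lia.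
have disj (A B : {set 'I_n * 'I_n}) : (forall p, p \in A -> p \notin B) ->
    #|A :|: B| = (#|A| + #|B|)%N.
  move=> AB; rewrite cardsU (_ : A :&: B = finset.set0) ?cards0 ?subn0 //.
  by apply/setP => p; rewrite !inE; apply/negbTE/negP => /andP[/AB/negP].
rewrite !disj ?cU ?cL; first by rewrite mul2n addnn.
- by move=> [i j]; rewrite !inE /=; lia.
- by move=> [i j]; rewrite !inE /=; lia.
Qed.

Lemma banded_dim r : (0 < n)%N -> (r <= n - 1)%N ->
  has_dim (banded R n r) (n + 2 * \sum_(1 <= l < r.+1) (n - l)).
Proof.
by move=> n0 rn; rewrite bandedE -card_band_set //; exact: coord_space_dim.
Qed.

End CoordinateSpaces.

(** * Removing an outer diagonal by a bidiagonal factor *)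

Section BandElimination.
Variables (F : fieldType) (n : nat).
Local Notation M := 'M[F]_n.+1.
Implicit Types (A B : M) (p q k : nat) (m : nat -> F).

(** Lower bandwidth [p] and upper bandwidth [q], kept apart because a
    bidiagonal factor changes only one of them. *)
Definition band p q A := forall i j : 'I_n.+1,
  (j + p < i)%N || (i + q < j)%N -> A i j = 0.

(** The entries on the two outermost diagonals are the pivots of the next
    elimination step. *)
Definition edge p q A := forall i j : 'I_n.+1,
  (i == j + p :> nat)%N || (j == i + q :> nat)%N -> A i j != 0.

Lemma band_mul p q p' q' A B :
  band p q A -> band p' q' B -> band (p + p') (q + q') (A *m B).
Proof.
move=> Ab Bb i j ij; rewrite mxE big1 // => k _.
have [ik|ik] := boolP ((k + p < i)%N || (i + q < k)%N); first by rewrite Ab ?mul0r.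
by rewrite Bb ?mulr0 //; move: ij ik; lia.
Qed.

Definition lower_bidiag m : M :=
  \matrix_(i, j) ((i == j)%:R + (i == j.+1 :> nat)%:R * m j).

Lemma lower_bidiag_band m : band 1 0 (lower_bidiag m).
Proof.
move=> i j ij; rewrite mxE -val_eqE /=.
have /negbTE-> : (i != j :> nat)%N by move: ij; lia.
have /negbTE-> : (i != j.+1 :> nat)%N by move: ij; lia.
by rewrite mul0r addr0.
Qed.

Lemma lower_bidiag_mul m A i j : (lower_bidiag m *m A) i j =
  A i j + (if (i : nat) is k.+1 then m k * A (inord k) j else 0).
Proof.
rewrite mxE; under eq_bigr do rewrite mxE mulrDl.
rewrite big_split /= (bigD1 i) //= eqxx mul1r big1 ?addr0; last first.
  by move=> k ki; rewrite eq_sym (negbTE ki) mul0r.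
congr (_ + _); case: i => [[|k] ik] /=.
  by rewrite big1 // => k _; rewrite !mul0r.
have kn : (k < n.+1)%N by lia.
rewrite (bigD1 (inord k)) //= inordK // eqxx mul1r big1 ?addr0 // => k' k'k.
rewrite eqSS (negbTE (_ : k != k' :> nat)%N) ?mul0r //.
by apply: contra k'k => /eqP kk'; rewrite kk' inord_val.
Qed.

(** The multiple of row [k] subtracted from row [k.+1] is that of the already
    transformed row [k]: this makes the factor undoing the elimination
    bidiagonal, rather than its inverse. It is chosen to cancel the entry of row
    [k.+1] in column [k - p], which is on the diagonal at distance [p.+1]. *)
Fixpoint elim_row p A i : 'rV[F]_n.+1 :=
  if i is k.+1 then
    row (inord k.+1) A - (if (p <= k)%N then A (inord k.+1) (inord (k - p))
      / elim_row p A k 0 (inord (k - p)) else 0) *: elim_row p A k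
  else row (inord 0) A.

Definition pivot p A k := elim_row p A k 0 (inord (k - p)).

Definition multiplier p A k :=
  if (p <= k)%N then A (inord k.+1) (inord (k - p)) / pivot p A k else 0.

Definition elim p A : M := \matrix_i elim_row p A i.

Definition pivots_neq0 p A := forall k, (k < n)%N -> (p <= k)%N -> pivot p A k != 0.

Lemma elim_rowS p A k :
  elim_row p A k.+1 = row (inord k.+1) A - multiplier p A k *: elim_row p A k.
Proof. by []. Qed.

(** Row by row, this is the recursion defining [elim_row] read backwards. *)
Lemma elim_factor p A : A = lower_bidiag (multiplier p A) *m elim p A.
Proof.
apply/matrixP => i j; rewrite lower_bidiag_mul [elim _ _ i j]mxE.
case: i => [[|k] ik] /=.
  rewrite addr0 mxE; congr (A _ _); exact/val_inj/esym/inordK.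
rewrite -/(pivot p A k) -/(multiplier p A k).
have kn : (k < n.+1)%N by lia.
rewrite !mxE inordK // subrK; congr (A _ _); exact/val_inj/esym/inordK.
Qed.

(** In row [k.+1], the entries left of column [k - p] are zero in both rows
    combined, the one in column [k - p] is cancelled, and on the right nothing
    is created since row [k] ends before row [k.+1] may. *)
Lemma elim_band p q A :
  band p.+1 q A -> pivots_neq0 p A -> band p q (elim p A).
Proof.
move=> Ab piv.
suff rowb i (j : 'I_n.+1) : (i <= n)%N -> (j + p < i)%N || (i + q < j)%N ->
    elim_row p A i 0 j = 0.
  by move=> i j ij; rewrite mxE; apply: rowb => //; rewrite -ltnS.
elim: i => [|k IH] kn ij.
  by rewrite mxE; apply: Ab; rewrite inordK.
rewrite elim_rowS !mxE; have [jk|jk] := eqVneq (j + p)%N k; last first.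
  rewrite IH ?(ltnW kn) // ?mulr0 ?subr0; last by move: ij jk; lia.
  by apply: Ab; rewrite inordK //; move: ij jk; lia.
have pk : (p <= k)%N by rewrite -jk leq_addl.
have jE : inord (k - p) = j by rewrite -jk addnK inord_val.
have := piv k kn pk; rewrite /multiplier pk /pivot jE => pivk.
by rewrite divfK // subrr.
Qed.

(** A point where the elimination is defined and gives back [A]: the multipliers
    of [extend p A] are all [1]. *)
Definition extend p A := lower_bidiag (fun k => (p <= k)%:R) *m A.

Lemma extendE p A i j : extend p A i j =
  A i j + (if (i : nat) is k.+1 then (p <= k)%:R * A (inord k) j else 0).
Proof. exact: lower_bidiag_mul. Qed.

Lemma extend_band p q A : band p q A -> band p.+1 q (extend p A).
Proof.
move=> Ab; rewrite -add1n -[q]add0n.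
by apply: band_mul => //; exact: lower_bidiag_band.
Qed.

Lemma extend_edge p q A :
  band p q A -> edge p q A -> edge p.+1 q (extend p A).
Proof.
move=> Ab Ae i j ij; rewrite extendE.
case: i ij => [[|k] ik] /= ij.
  by rewrite addr0; apply: Ae; move: ij => /=; lia.
have kn : (k < n.+1)%N by lia.
have [ik'|ik'] := eqVneq k.+1 (j + p.+1)%N.
  rewrite Ab /= ?add0r; last by lia.
  have -> : (p <= k)%N by lia.
  by rewrite mul1r; apply: Ae; rewrite inordK //; lia.
rewrite [X in _ + _ * X]Ab ?mulr0 ?addr0; last by rewrite inordK //; lia.
by apply: Ae => /=; lia.
Qed.

Lemma elim_row_extend p q A i : band p q A -> edge p q A -> (i <= n)%N ->
  elim_row p (extend p A) i = row (inord i) A.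
Proof.
have rowE i' (B : M) j : row i' B 0 j = B i' j by rewrite mxE.
have subE c (u v : 'rV[F]_n.+1) j : (u - c *: v) 0 j = u 0 j - c * v 0 j.
  by rewrite !mxE.
move=> Ab Ae; elim: i => [|k IH] kn.
  by apply/rowP => j; rewrite /= !rowE extendE inordK // addr0.
rewrite elim_rowS /multiplier /pivot (IH (ltnW kn)).
apply/rowP => j; rewrite subE !rowE.
rewrite !extendE inordK //=.
case: leqP => pk; last by rewrite !mul0r addr0 subr0.
rewrite (Ab (inord k.+1) (inord (k - p))) ?add0r; last by rewrite !inordK; lia.
rewrite !mul1r divff ?mul1r ?addrK //.
by apply: Ae; rewrite !inordK; lia.
Qed.

Lemma elim_extend p q A : band p q A -> edge p q A -> elim p (extend p A) = A.
Proof.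
move=> Ab Ae; apply/matrixP => i j.
by rewrite mxE (elim_row_extend Ab Ae) -1?ltnS // mxE inord_val.
Qed.

Lemma extend_pivots p q A :
  band p q A -> edge p q A -> pivots_neq0 p (extend p A).
Proof.
move=> Ab Ae k kn pk; rewrite /pivot (elim_row_extend Ab Ae) ?(ltnW kn) // mxE.
by apply: Ae; rewrite !inordK; lia.
Qed.

(** Conjugation by the permutation reversing the basis; it exchanges lower and
    upper. *)
Definition flip A : M := \matrix_(i, j) A (rev_ord i) (rev_ord j).

Lemma flipK : involutive flip.
Proof. by move=> A; apply/matrixP => i j; rewrite !mxE !rev_ordK. Qed.

Lemma flipM A B : flip (A *m B) = flip A *m flip B.
Proof.
apply/matrixP => i j; rewrite !mxE (reindex_inj rev_ord_inj) /=.
by apply: eq_bigr => k _; rewrite !mxE.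
Qed.

Lemma flip_band p q A : band p q A -> band q p (flip A).
Proof.
move=> Ab i j ij; rewrite mxE Ab //=.
by have := ltn_ord i; have := ltn_ord j; move: ij; lia.
Qed.

Lemma flip_edge p q A : edge p q A -> edge q p (flip A).
Proof.
move=> Ae i j ij; rewrite mxE Ae //=.
by have := ltn_ord i; have := ltn_ord j; move: ij; lia.
Qed.

End BandElimination.

(** * Generic band matrices are products of tridiagonal ones *)

Section GenericFactorization.
Variables (R : realType) (n : nat).
Local Notation C := R[i].
Local Notation M := 'M[C]_n.+1.
Implicit Types (A x : M) (P : M -> Prop).

Lemma elim_row_regular p x0 i j : (i <= n)%N -> pivots_neq0 p x0 ->
  regular_at x0 (fun x => elim_row p x i 0 j).
Proof.
move=> + piv; elim: i j => [|k IH] j kn.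
  by under eq_fun do rewrite mxE; exact: regular_entry.
under eq_fun do rewrite elim_rowS !mxE; apply: regularD; first exact: regular_entry.
apply: regularN; apply: regularM; last exact: IH (ltnW kn).
rewrite /multiplier; case: leqP => pk; last exact: regular_cst.
apply: regularM; first exact: regular_entry.
by apply: regularV; [exact: IH (ltnW kn)|exact: piv].
Qed.

Lemma znear_pivots p x0 : pivots_neq0 p x0 -> znear x0 (pivots_neq0 p).
Proof.
move=> piv; apply: znear_forall_lt => k kn.
have [pk|pk] := leqP p k; last by apply: znear_always => x; lia.
apply: znear_sub (znear_neq0 (elim_row_regular _ (ltnW kn) piv) (piv k kn pk)).
by move=> x ? _.
Qed.

(** A property [P] that is generic near [A0] is inherited by the quotient of the
    generic wider band matrix [x] by its lower bidiagonal factor. *)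
Lemma lower_factor_near p q A0 P : band p q A0 -> edge p q A0 -> znear A0 P ->
  exists x0, [/\ band p.+1 q x0, edge p.+1 q x0 & znear x0 (fun x =>
    band p.+1 q x -> exists L A, [/\ x = L *m A, band 1 0 L, band p q A & P A])].
Proof.
move=> A0b A0e A0P; exists (extend p A0); split.
- exact: extend_band.
- exact: extend_edge.
have piv := extend_pivots A0b A0e.
have elimP : znear (extend p A0) (fun x => P (elim p x)).
  apply: znear_comp; last by rewrite (elim_extend A0b A0e).
  move=> i j; under eq_fun do rewrite mxE; apply: elim_row_regular => //.
  by rewrite -ltnS.
apply: znear_sub (znearI (znear_pivots piv) elimP) => x [xpiv xP] xb.
exists (lower_bidiag n (multiplier p x)), (elim p x); split=> //.
- exact: elim_factor.
- exact: lower_bidiag_band.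
- exact: elim_band.
Qed.

Lemma znear_flip A0 P : znear A0 P -> znear (flip A0) (fun x => P (flip x)).
Proof.
move=> A0P; apply: znear_comp; last by rewrite flipK.
by move=> i j; under eq_fun do rewrite mxE; exact: regular_entry.
Qed.

(** The mirror image of [lower_factor_near] under [flip]. *)
Lemma upper_factor_near p q A0 P : band p q A0 -> edge p q A0 -> znear A0 P ->
  exists x0, [/\ band p q.+1 x0, edge p q.+1 x0 & znear x0 (fun x =>
    band p q.+1 x -> exists U A, [/\ x = U *m A, band 0 1 U, band p q A & P A])].
Proof.
move=> A0b A0e A0P.
have [x0 [x0b x0e x0P]] :=
  lower_factor_near (flip_band A0b) (flip_edge A0e) (znear_flip A0P).
exists (flip x0); split; [exact: flip_band|exact: flip_edge|].
apply: znear_sub (znear_flip x0P) => x xP /flip_band/xP[L [A [xE Lb Ab AP]]].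
exists (flip L), (flip A); split=> //; [|exact: flip_band|exact: flip_band].
by rewrite -flipM -xE flipK.
Qed.

Lemma banded_band r : banded R n.+1 r = [set x | band r r x].
Proof. by apply/seteqP; split=> x xb i j ij; apply: xb; move: ij; lia. Qed.

Lemma mu0_cons (X : set M) r T A : X T -> mu0 r X A -> mu0 r.+1 X (T *m A).
Proof.
move=> XT [Ms [XMs ->]].
exists (fun i => if unlift ord0 i is Some j then Ms j else T); split.
  by move=> i; case: unliftP.
rewrite big_ord_recl unlift_none; congr (_ *m _).
by apply: eq_bigr => i _; rewrite liftK.
Qed.

Lemma mu0_1 (X : set M) A : X A -> mu0 1 X A.
Proof. by move=> XA; exists (fun=> A); split=> //; rewrite big_ord1. Qed.

Lemma mu0_uncons (X : set M) r A : mu0 r.+1 X A ->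
  exists T B, [/\ X T, mu0 r X B & A = T *m B].
Proof.
move=> [Ms [XMs ->]]; exists (Ms ord0), (\prod_(i < r) Ms (lift ord0 i)).
by split=> //; [exists (fun i => Ms (lift ord0 i))|rewrite big_ord_recl].
Qed.

Lemma mu0_tridiagonal_banded r A : mu0 r (tridiagonal R n.+1) A -> band r r A.
Proof.
elim: r A => [|r IH] A.
  move=> [Ms [_ ->]] i j ij; rewrite big_ord0 mxE -val_eqE /=.
  by rewrite (negbTE (_ : i != j :> nat)) //; move: ij; lia.
move=> /mu0_uncons[T [B [Tb /IH Bb ->]]]; rewrite -[r.+1]add1n.
by apply: band_mul => //; move: Tb; rewrite /tridiagonal banded_band.
Qed.

(** Each widening of the band by one on both sides costs a lower and an upper
    bidiagonal factor, whose product is a single tridiagonal matrix. *)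
Lemma generic_tridiagonal_product r : (0 < r)%N -> exists x0,
  [/\ band r r x0, edge r r x0 &
    znear x0 (fun x => band r r x -> mu0 r (tridiagonal R n.+1) x)].
Proof.
case: r => // r _; elim: r => [|r [A0 [A0b A0e A0P]]].
  exists (\matrix_(i, j) (`|i - j|%N <= 1)%N%:R); split.
  - move=> i j ij; rewrite mxE (_ : (_ <= _)%N = false) //; move: ij; lia.
  - move=> i j ij; rewrite mxE (_ : (_ <= _)%N) ?oner_neq0 //; move: ij; lia.
  - apply: znear_always => x xb; apply: mu0_1.
    by rewrite /tridiagonal banded_band.
have [A1 [A1b A1e A1P]] := upper_factor_near A0b A0e A0P.
have [A2 [A2b A2e A2P]] := lower_factor_near A1b A1e A1P.
exists A2; split=> //; apply: znear_sub A2P => x xP /xP[L [y [-> Lb yb yP]]].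
have [U [A [-> Ub Ab AP]]] := yP yb.
rewrite mulmxA; apply: mu0_cons; last exact: AP.
rewrite /tridiagonal banded_band; exact: (band_mul Lb Ub).
Qed.

End GenericFactorization.

(** * Closures and lengths of tridiagonal factorizations *)

Section TridiagonalProducts.
Variables (R : realType) (n : nat).
Local Notation C := R[i].
Local Notation M := 'M[C]_n.+1.
Local Notation TD := (tridiagonal R n.+1).
Implicit Types (A B x y : M) (P : M -> Prop).

(** If [f] vanishes on the products and [g] is nonzero only on products, then
    [g * f] vanishes on all band matrices; irreducibility gives [f = 0]. *)
Lemma mu_tridiagonal r : (0 < r)%N -> mu r TD = banded R n.+1 r.
Proof.
move=> r0; have bc : zariski_irreducible (banded R n.+1 r).
  by rewrite bandedE; exact: coord_space_irreducible.
apply/seteqP; split=> x.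
  apply; split; first by case: bc.
  by rewrite banded_band => A; exact: mu0_tridiagonal_banded.
move=> xb Z [Zc Zmu]; apply: contrapT => /(closed_separated Zc)[f [fP fZ /eqP]].
have [x0 [x0b _ [g [gP gx0 gmu]]]] := @generic_tridiagonal_product R n r r0.
apply; apply: (irreducible_domain bc gP fP) => //; last first.
  by exists x0 => //; rewrite banded_band.
move=> y; rewrite banded_band => yb.
have [->|gy] := eqVneq (g y) 0; first by rewrite mul0r.
by rewrite fZ ?mulr0 //; apply: Zmu; exact: gmu.
Qed.

Lemma band_full A : band n n A.
Proof. by move=> i j; have := ltn_ord i; have := ltn_ord j; lia. Qed.

Lemma banded_full : banded R n.+1 n = [set: M].
Proof. by rewrite banded_band; apply/seteqP; split=> // A _; exact: band_full. Qed.

Lemma banded_proper r : (r < n)%N -> banded R n.+1 r <> [set: M].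
Proof.
move=> rn rT; have : banded R n.+1 r (const_mx 1) by rewrite rT.
move=> /(_ ord0 ord_max); rewrite mxE => one0.
by have /eqP := one0 (ltac:(rewrite /=; lia)); rewrite oner_eq0.
Qed.

Lemma mu0_cat (X : set M) r s A B :
  mu0 r X A -> mu0 s X B -> mu0 (r + s) X (A *m B).
Proof.
elim: r A => [|r IH] A; first by move=> [Ms [_ ->]] ?; rewrite big_ord0 mul1mx.
move=> /mu0_uncons[T [A' [XT XA' ->]]] XB; rewrite -mulmxA addSn.
by apply: mu0_cons => //; exact: IH.
Qed.

Lemma mu0_diagonal_mul r D A : (0 < r)%N -> band 0 0 D ->
  mu0 r TD A -> mu0 r TD (D *m A).
Proof.
case: r => // r _ Db /mu0_uncons[T [B [Tb XB ->]]]; rewrite mulmxA.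
apply: mu0_cons => //; move: Tb; rewrite /tridiagonal banded_band => Tb.
exact: (band_mul Db Tb).
Qed.

Lemma regular_det m x0 (G : M -> 'M[C]_m) :
  (forall i j, regular_at x0 (fun x => G x i j)) ->
  regular_at x0 (fun x => \det (G x)).
Proof.
move=> GP; apply: regular_sum => s; apply: regularM; first exact: regular_cst.
by apply: regular_prod => i; exact: GP.
Qed.

(** Equal to [invmx x] on invertible matrices, in the form that exhibits its
    entries as rational functions. *)
Definition adj_inv x := (\det x)^-1 *: \adj x.

Lemma adj_invVx x : x \in unitmx -> adj_inv x *m x = 1%:M.
Proof.
by move=> xu; rewrite -scalemxAl mul_adj_mx scale_scalar_mx mulVf // -unitfE.
Qed.

Lemma regular_adj_inv x0 i j : x0 \in unitmx ->
  regular_at x0 (fun x => adj_inv x i j).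
Proof.
move=> x0u; under eq_fun do rewrite !mxE; apply: regularM.
  apply: regularV; last by rewrite -unitfE.
  by apply: regular_det => i' j'; exact: regular_entry.
apply: regularM; first exact: regular_cst.
apply: regular_det => i' j'; under eq_fun do rewrite !mxE; exact: regular_entry.
Qed.

Lemma znear_unitmx x0 : x0 \in unitmx -> znear x0 (fun x => x \in unitmx).
Proof.
rewrite unitmxE unitfE => det0; under eq_fun do rewrite unitmxE unitfE.
apply: znear_neq0 det0; apply: regular_det => i j; exact: regular_entry.
Qed.

Lemma znear_znear x0 P : znear x0 P -> znear x0 (fun y => znear y P).
Proof. by move=> [f [fP f0 fE]]; exists f; split=> // y fy; exists f. Qed.

(** Among the [D], both [P D] and [P (A *m invmx D)] hold on nonempty open sets,
    which must meet. The second set is nonempty because it contains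
    [invmx y *m A] for any invertible [y] near which [P] holds. *)
Lemma unitmx_mul_generic x0 P A : znear x0 P -> A \in unitmx ->
  exists B D, [/\ P B, P D & A = B *m D].
Proof.
move=> x0P Au.
have [y [yP yu]] := znear_meet (znear_znear x0P) (znear_unitmx (unitmx1 C n.+1)).
pose D0 := invmx y *m A.
have D0u : D0 \in unitmx by rewrite unitmx_mul unitmx_inv yu.
have BD0 : A *m adj_inv D0 = y.
  have -> : A = y *m D0 by rewrite mulKVmx.
  by rewrite -mulmxA (mulmx1C (adj_invVx D0u)) mulmx1.
have nearB : znear D0 (fun D => P (A *m adj_inv D)).
  apply: (@znear_comp _ _ _ (fun D => A *m adj_inv D)); last by rewrite BD0.
  move=> i j; under eq_fun do rewrite mxE; apply: regular_sum => k.
  by apply: regularM; [exact: regular_cst|exact: regular_adj_inv].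
have [D [DP [BP Du]]] := znear_meet yP (znearI nearB (znear_unitmx D0u)).
by exists (A *m adj_inv D), D; split=> //; rewrite -mulmxA adj_invVx // mulmx1.
Qed.

Lemma mu0_unitmx A : (0 < n)%N -> A \in unitmx -> mu0 (n + n) TD A.
Proof.
move=> n0 Au; have [x0 [_ _ x0P]] := @generic_tridiagonal_product R n n n0.
have [B [D [BP DP ->]]] := unitmx_mul_generic x0P Au.
by apply: mu0_cat; [exact/BP/band_full|exact/DP/band_full].
Qed.

(** By Gaussian elimination [A] is an invertible matrix, times a diagonal
    idempotent, times an invertible matrix; the idempotent merges with the first
    tridiagonal factor of the latter. *)
Lemma mu0_full : (0 < n)%N -> mu0 (4 * n) TD = [set: M].
Proof.
move=> n0; apply/seteqP; split=> // A _.
have -> : (4 * n = (n + n) + (n + n))%N by lia.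
rewrite -[A]mulmx_ebase -mulmxA; apply: mu0_cat.
  by apply: mu0_unitmx => //; exact: col_ebase_unit.
apply: mu0_diagonal_mul; first by rewrite addn_gt0 n0.
  move=> i j ij; rewrite mxE; case: andP => // -[/eqP ij' _].
  by move: ij; rewrite ij'; lia.
by apply: mu0_unitmx => //; exact: row_ebase_unit.
Qed.

Lemma is_min_exists (S : set nat) m : S m -> exists k, is_min S k /\ (k <= m)%N.
Proof.
move=> Sm; have exS : exists k, `[< S k >] by exists m; exact/asboolP.
case: (ex_minnP exS) => k /asboolP Sk kmin.
by exists k; split; [split=> // j /asboolP/kmin|apply: kmin; exact/asboolP].
Qed.

End TridiagonalProducts.

Theorem theorem4p10 (R : realType) (n : nat) (hn : (2 <= n)%N) :
  (forall r : nat, (1 <= r)%N -> (r <= n - 1)%N ->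
     mu r (tridiagonal R n) = banded R n r /\
     has_dim (mu r (tridiagonal R n))
       (n + 2 * \sum_(1 <= l < r.+1) (n - l))%N) /\
  is_FL_gen (tridiagonal R n) (n - 1)%N /\
  (exists m : nat, is_FL_max (tridiagonal R n) m /\ (m <= 4 * (n - 1))%N).
Proof.
case: n hn => // n n0; rewrite subn1 /=; split=> [r r0 rn|].
  by rewrite mu_tridiagonal //; split=> //; apply: banded_dim; rewrite ?subn1.
split.
  split; first by split=> //; rewrite mu_tridiagonal // banded_full.
  move=> k [k0]; rewrite mu_tridiagonal // => kT; rewrite leqNgt.
  by apply/negP => kn; exact: banded_proper kn kT.
apply: is_min_exists; split; first by rewrite muln_gt0.
exact: mu0_full.
Qed.
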